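(* Let $\mathcal{H}$ and $\mathcal{G}$ be real Hilbert spaces, let $L\colon\mathcal{H}\to\mathcal{G}$ be a bounded linear operator, let $B\colon\mathcal{G}\to 2^{\mathcal{G}}$ be a set-valued operator, let $\gamma\in(0,+\infty)$, and let $\rho\in(0,+\infty)$. Then the following hold: (i) $\operatorname{dom}(L\overset{\gamma}{\diamond}B)\subset L^*(\operatorname{dom}B)$. (ii) $\operatorname{ran}(L\overset{\gamma}{\bullet}B)\subset L^*(\operatorname{ran}B)$. (iii) $L\overset{\gamma}{\diamond}B=(L\overset{1/\gamma}{\bullet}B^{-1})^{-1}$. (iv) $\rho(L\overset{\gamma}{\diamond}B)=L\overset{\gamma/\rho}{\diamond}(\rho B)$. (v) $(L\overset{\gamma}{\diamond}B)(\rho\,\mathrm{Id}_{\mathcal{H}})=L\overset{\gamma/\rho}{\diamond}(B(\rho\,\mathrm{Id}_{\mathcal{G}}))$. (vi) $\rho(L\overset{\gamma}{\bullet}B)=L\overset{\gamma/\rho}{\bullet}(\rho B)$. (vii) $(L\overset{\gamma}{\bullet}B)(\rho\,\mathrm{Id}_{\mathcal{H}})=L\overset{\gamma/\rho}{\bullet}(B(\rho\,\mathrm{Id}_{\mathcal{G}}))$. (viii) Let $z\in\mathcal{H}$. Then (a) $(L\overset{\gamma}{\diamond}B)-z=L\overset{\gamma}{\diamond}(B-Lz)$; (b) $\tau_z(L\overset{\gamma}{\bullet}B)=L\overset{\gamma}{\bullet}(\tau_{Lz}B)$, where, for a set-valued operator $C$ and a vector $w$ of the underlying space, $\tau_wC\colon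 x\mapsto C(x-w)$. (ix) Let $\mathcal{K}$ be a real Hilbert space and let $S\colon\mathcal{K}\to\mathcal{H}$ be a bounded linear operator. Then (a) $S\overset{\gamma}{\diamond}(L\overset{\gamma}{\diamond}B)=(L\circ S)\overset{\gamma}{\diamond}B$; (b) $S\overset{\gamma}{\bullet}(L\overset{\gamma}{\bullet}B)=(L\circ S)\overset{\gamma}{\bullet}B$. (x) Set $\beta=\gamma/(1+\rho\gamma)$. Then $L\overset{\gamma}{\diamond}(B+\rho\,\mathrm{Id}_{\mathcal{G}})=(L\overset{\beta}{\diamond}B)+\rho\,\mathrm{Id}_{\mathcal{H}}$. (xi) ${}^{\rho}\bigl(L\overset{\gamma+\rho}{\bullet}B\bigr)=L\overset{\gamma}{\bullet}({}^{\rho}B)$. (xii) ${}^{\gamma}\bigl(L\overset{\gamma}{\bullet}B\bigr)=L^*\circ({}^{\gamma}B)\circ L$. (xiii) $\operatorname{zer}(L\overset{\gamma}{\bullet}B)=\operatorname{zer}(L^*\circ({}^{\gamma}B)\circ L)$.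
   Context: For a set-valued operator $A\colon\mathcal{H}\to 2^{\mathcal{H}}$: $\operatorname{dom}A=\{x\mid Ax\neq\varnothing\}$, $\operatorname{ran}A=\{x^*\mid \exists x,\ x^*\in Ax\}$, $\operatorname{zer}A=\{x\mid 0\in Ax\}$, and $A^{-1}$ is defined by $x\in A^{-1}x^*\Leftrightarrow x^*\in Ax$. Single-valued maps are identified with set-valued ones; sums, scalar multiples and compositions of set-valued operators are pointwise, e.g. $(L^*\circ C\circ L)x=\{L^*y\mid y\in C(Lx)\}$; $A(\rho\,\mathrm{Id})\colon x\mapsto A(\rho x)$; $(A-z)\colon x\mapsto Ax-z$. The Yosida approximation of $A$ of index $\gamma>0$ is ${}^{\gamma}A=(A^{-1}+\gamma\,\mathrm{Id})^{-1}$, equivalently $\gamma^{-1}(\mathrm{Id}-J_{\gamma A})$ with $J_{\gamma A}=(\mathrm{Id}+\gamma A)^{-1}$. For a bounded linear $L\colon\mathcal{H}\to\mathcal{G}$ with adjoint $L^*$ and $C\colon\mathcal{G}\to2^{\mathcal{G}}$, the parallel composition is $L^*\triangleright C=(L^*\circ C^{-1}\circ L)^{-1}\colon\mathcal{H}\to2^{\mathcal{H}}$. For $\gamma>0$, the resolvent composition is $L\overset{\gamma}{\diamond}C=L^*\triangleright(C+\gamma^{-1}\mathrm{Id}_{\mathcal{G}})-\gamma^{-1}\mathrm{Id}_{\mathcal{H}}\colon\mathcal{H}\to2^{\mathcal{H}}$, and the resolvent cocomposition is $L\overset{\gamma}{\bullet}C=(L\overset{1/\gamma}{\diamond}C^{-1})^{-1}\colon\mathcal{H}\to2^{\mathcal{H}}$.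 *)

(* Defs.v *)
From HB Require Import structures.
From mathcomp Require Import all_boot all_order all_algebra.
From mathcomp Require Import sesquilinear.
From mathcomp Require Import all_classical all_reals.
From mathcomp Require Import topology normedtype.

Set Implicit Arguments.
Unset Strict Implicit.
Unset Printing Implicit Defensive.

Import Order.TTheory GRing.Theory Num.Theory.
Import numFieldNormedType.Exports.

Local Open Scope classical_set_scope.
Local Open Scope ring_scope.

(* [{dot V for idfun}] is the type of symmetric positive definite bilinear
   forms on the real vector space [V]. *)
HB.mixin Record isHilbert (R : realType) V & CompleteNormedModule R V := {
  inner : {dot V for (@idfun R)} ;
  norm_inner : forall x : V, `|x| = Num.sqrt (inner x x)
}.

#[short(type="hilbertType")]
HB.structure Definition Hilbert (R : realType) :=
  {V of isHilbert R V & CompleteNormedModule R V}.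

Section BoundedOperator.
Variables (R : realType) (H G : hilbertType R).

Definition bounded_operator (L : H -> G) : Prop :=
  exists M : R, forall x, `|L x| <= M * `|x|.

(* When [L] is linear and bounded, the set below is a singleton for every [y]
   (existence is the Riesz representation theorem); the default value [0] is
   never used. *)
Definition adjoint (L : H -> G) (y : G) : H :=
  xget 0 [set x | forall u : H, inner (L u) y = inner u x].

End BoundedOperator.

Section SetValued.
Variables V W : Type.
Implicit Type A : V -> set W.

Definition sv_dom A : set V := [set x | A x !=set0].

Definition sv_ran A : set W := [set y | exists x, A x y].

Definition sv_inv A : W -> set V := fun y => [set x | A x y].

Definition sv_fun (f : V -> W) : V -> set W := fun x => [set f x].

End SetValued.

Section SetValuedAlgebra.
Variables (R : realType) (V : lmodType R).
Implicit Types A B : V -> set V.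

Definition sv_zer A : set V := [set x | A x 0].

Definition sv_add A B : V -> set V :=
  fun x => [set a + b | a in A x & b in B x].

Definition sv_sub A B : V -> set V :=
  fun x => [set a - b | a in A x & b in B x].

Definition sv_scale (c : R) A : V -> set V :=
  fun x => [set c *: a | a in A x].

Definition sv_scaleid (c : R) : V -> set V := sv_fun (fun x => c *: x).

Definition sv_prescale A (c : R) : V -> set V := fun x => A (c *: x).

Definition sv_subvec A (z : V) : V -> set V :=
  fun x => [set a - z | a in A x].

Definition sv_translate (w : V) A : V -> set V := fun x => A (x - w).

Definition yosida (c : R) A : V -> set V :=
  sv_inv (sv_add (sv_inv A) (sv_scaleid c)).

End SetValuedAlgebra.

Arguments sv_scaleid {R} V c.

Section ResolventComposition.
Variables (R : realType) (H G : hilbertType R).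
Implicit Types (L : H -> G) (C : G -> set G).

Definition adj_conj L C : H -> set H := fun x => adjoint L @` C (L x).

(* The parallel composition of [C] by the adjoint of [L]: the argument is [L],
   not its adjoint. *)
Definition parallel_adj_comp L C : H -> set H :=
  sv_inv (adj_conj L (sv_inv C)).

Definition resolvent_comp L (c : R) C : H -> set H :=
  sv_sub (parallel_adj_comp L (sv_add C (sv_scaleid G c^-1)))
         (sv_scaleid H c^-1).

Definition resolvent_cocomp L (c : R) C : H -> set H :=
  sv_inv (resolvent_comp L c^-1 (sv_inv C)).

End ResolventComposition.

(* Main.v *)
(* Unfolding the definitions, [w] belongs to the resolvent composition of [B] at
   [x] iff some [y] satisfies [L^* y = x] and [L (w + x / c) - y / c \in B y];
   dually, [w] belongs to the cocomposition at [x] iff some [y] satisfies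
   [L^* y = w] and [y \in B (L (x + c w) - c y)]. Each identity then reduces to an
   equality between arguments of [B], together with the homogeneity of [L^*] and
   [(L \o S)^* = S^* \o L^*], which rest on the Riesz representation theorem. *)
Require Import Defs.
From HB Require Import structures.
From mathcomp Require Import all_boot all_order all_algebra.
From mathcomp Require Import sesquilinear ring lra.
From mathcomp Require Import all_classical all_reals.
From mathcomp Require Import interval_inference topology normedtype sequences.

Import Order.TTheory GRing.Theory Num.Theory.
Import numFieldNormedType.Exports.

Local Open Scope classical_set_scope.
Local Open Scope ring_scope.

(** * Inner product calculus and the Cauchy-Schwarz inequality *)

Section Inner.
Context {R : realType} {H : hilbertType R}.
Implicit Types (x y z : H) (a : R).

Lemma innerC x y : inner x y = inner y x.
Proof. by rewrite (hermC inner) expr0 mul1r. Qed.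

Lemma innerDr x y z : inner x (y + z) = inner x y + inner x z.
Proof. exact: linearDr. Qed.

Lemma innerZr a x y : inner x (a *: y) = a * inner x y.
Proof. exact: linearZr_LR. Qed.

Lemma innerDl x y z : inner (x + y) z = inner x z + inner y z.
Proof. by rewrite innerC innerDr !(innerC z). Qed.

Lemma innerZl a x y : inner (a *: x) y = a * inner x y.
Proof. by rewrite innerC innerZr innerC. Qed.

Lemma inner0r x : inner x 0 = 0.
Proof. exact: linear0r. Qed.

Lemma innerBr x y z : inner x (y - z) = inner x y - inner x z.
Proof. by rewrite innerDr -scaleN1r innerZr mulN1r. Qed.

Lemma innerBl x y z : inner (x - y) z = inner x z - inner y z.
Proof. by rewrite innerC innerBr !(innerC z). Qed.

Lemma inner_gt0 x : x != 0 -> 0 < inner x x.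
Proof. exact: neq0_dnorm_gt0. Qed.

Lemma inner_ge0 x : 0 <= inner x x.
Proof.
have [->|/inner_gt0/ltW//] := eqVneq x 0.
by rewrite inner0r.
Qed.

Lemma sqr_norm_inner x : `|x| ^+ 2 = inner x x.
Proof. by rewrite norm_inner sqr_sqrtr ?inner_ge0. Qed.

Lemma inner_eqP x y : (forall u, inner u x = inner u y) -> x = y.
Proof.
move=> xy; apply/eqP; rewrite -subr_eq0; apply: contraT => /inner_gt0.
by rewrite innerBr xy subrr ltxx.
Qed.

Lemma cauchy_schwarz x y : `|inner x y| <= `|x| * `|y|.
Proof.
rewrite -[leRHS]ger0_norm ?mulr_ge0// -ler_sqr ?nnegrE// !real_normK ?num_real//.
rewrite exprMn !sqr_norm_inner.
have [->|y0] := eqVneq y 0.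
  by rewrite !inner0r mulr0 expr0n.
rewrite -(ler_pM2l (inner_gt0 y y0)) -subr_ge0.
(* The square of this multiple of the component of [x] orthogonal to [y] equals [inner y y] times
   the required difference, without any division. *)
have := inner_ge0 (inner y y *: x - inner x y *: y).
rewrite innerBl !innerBr !innerZl !innerZr (innerC y x).
by congr (0 <= _); ring.
Qed.

End Inner.

(** * Riesz representation by minimization of a quadratic functional *)

Section Riesz.
Context {R : realType} {H : hilbertType R}.
Variables (f : H -> R) (M : R).
Hypothesis f_scalar : scalar f.
Hypothesis f_bounded : forall u, `|f u| <= M * `|u|.

Let fZ a u : f (a *: u) = a * f u.
Proof.
have f0 : f 0 = 0.
  have := f_scalar 1 0 0; rewrite scale1r addr0 mul1r => h.
  by apply: (addrI (f 0)); rewrite addr0 -h.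
by have := f_scalar a u 0; rewrite !addr0 f0 addr0.
Qed.

Let fD u v : f (u + v) = f u + f v.
Proof. by have := f_scalar 1 u v; rewrite scale1r mul1r. Qed.

Let J u := inner u u - 2 * f u.

(** Complete the square: [J u] is at least [|u|^2 - 2 M |u| = (|u| - M)^2 - M^2]. *)
Let J_lower u : - M ^+ 2 <= J u.
Proof.
rewrite /J -sqr_norm_inner.
have := le_trans (ler_norm _) (f_bounded u).
have := sqr_ge0 (`|u| - M); nra.
Qed.

(** The linear part of [J] cancels in the parallelogram law. Bounding [J] at the midpoint below by
    its infimum then controls the distance of two near-minimizers. *)
Let J_parallelogram u v :
  inner (u - v) (u - v) + 4 * J (2^-1 *: (u + v)) = 2 * (J u + J v).
Proof.
rewrite /J fZ fD innerBl !innerBr innerZl innerZr innerDl !innerDr (innerC v u).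
by field.
Qed.

Let J_line (t : R) u v :
  J (u + t *: v) = J u + 2 * t * (inner v u - f v) + t ^+ 2 * inner v v.
Proof.
rewrite /J fD fZ innerDl !innerDr !innerZl !innerZr (innerC u v).
by ring.
Qed.

(* The functional [J u = |u|^2 - 2 f u] is bounded below and strongly convex, so
   its minimizing sequences are Cauchy; vanishing of its derivative at the limit
   is the representation formula. *)
Lemma riesz_representation : exists x, forall u, f u = inner u x.
Proof.
pose m := inf (range J).
have hJ : has_inf (range J).
  by split; [exists (J 0), 0 | exists (- M ^+ 2) => _ [u _ <-]].
have mJ u : m <= J u by apply: ge_inf; [case: hJ | exists u].
have /choice[x xP] n : exists x, J x < m + n.+1%:R^-1.
  have [|_ [x _ <-]] := @inf_adherent _ (range J) (n.+1%:R^-1) _ hJ; last by exists x.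
  by rewrite invr_gt0.
have : cvg (x @ \oo).
  apply: cauchy_cvg; apply: cauchy_exP => e e0.
  (* Two values of [J] below [m + e^2 / 4] and a midpoint value at least [m] give a squared distance
     below [2 (2 m + e^2 / 2) - 4 m = e^2]. *)
  have [N _ NP] := near_infty_natSinv_lt (PosNum (divr_gt0 (exprn_gt0 2 e0) (ltr0n R 4))).
  exists (x N); exists N => // n /= Nn.
  have := NP N (leqnn N); have := NP n Nn => /= hn hN.
  rewrite -ball_normE /= -ltr_sqr ?nnegrE ?(ltW e0)// sqr_norm_inner.
  have := J_parallelogram (x N) (x n); have := mJ (2^-1 *: (x N + x n)).
  have := xP n; have := xP N; move: hn hN.
  move: (J _) (J _) (J _) (n.+1%:R^-1) (N.+1%:R^-1) (inner _ _) => a b c p q r.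
  lra.
move=> /cvg_ex[/= l xl]; exists l => u.
apply/eqP; rewrite eq_sym -subr_eq0; apply: contraT => d0.
pose d := `|inner u l - f u|; have {}d0 : 0 < d by rewrite normr_gt0.
have q1 : 0 < inner u u + 1 by rewrite ltr_wpDl ?inner_ge0.
have u1 : 0 < `|u| + 1 by rewrite ltr_wpDl.
(* [e1] bounds [inner u (l - x n)] by [d / 2] and [e2] bounds the half-derivative [c] at [x n] by
   [d / 2]; together they contradict the choice of [d]. Adding 1 keeps the denominators positive
   when [u = 0]. *)
pose e1 := d / 2 / (`|u| + 1); pose e2 := (d / 2) ^+ 2 / (inner u u + 1).
have e10 : 0 < e1 by rewrite !divr_gt0.
have e20 : 0 < e2 by rewrite !divr_gt0// exprn_gt0// divr_gt0.
have [n [/= n1 n2]] : exists n, `|l - x n| < e1 /\ n.+1%:R^-1 < e2.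
  have F : \forall n \near \oo, `|l - x n| < e1 /\ n.+1%:R^-1 < e2.
    near=> n; split; near: n; last exact: (near_infty_natSinv_lt (PosNum e20)).
    by move/cvgrPdist_lt : xl; apply.
  by case: F => N _ NP; exists N; apply: NP => /=.
pose c := inner u (x n) - f u.
have hc : `|c| < d / 2.
  rewrite -ltr_sqr ?nnegrE ?divr_ge0 ?(ltW d0)// real_normK ?num_real//.
  (* Nearly the optimal step along [u]: it lowers [J] by at least [c^2 / (q + 1)], yet [J (x n)]
     exceeds [m] by less than [w]. *)
  have := mJ (x n + (- c / (inner u u + 1)) *: u).
  rewrite J_line -/c; have := xP n; move: n2; rewrite ltr_pdivlMr//.
  set q := inner u u in q1 *; set w := n.+1%:R^-1 => n2 Jn.
  have -> : J (x n) + 2 * (- c / (q + 1)) * c + (- c / (q + 1)) ^+ 2 * q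
    = J (x n) - c ^+ 2 / (q + 1) - c ^+ 2 / (q + 1) ^+ 2.
    by field; rewrite gt_eqF.
  have : 0 <= c ^+ 2 / (q + 1) ^+ 2 by rewrite divr_ge0 ?sqr_ge0.
  move=> h1 h2; have : c ^+ 2 / (q + 1) < w by lra.
  by rewrite ltr_pdivrMr// => /lt_trans; apply.
suff : d < d by rewrite ltxx.
have {1}-> : d = `|inner u (l - x n) + c|.
  by rewrite innerBr /c addrA subrK.
have : `|inner u (l - x n)| <= d / 2.
  apply: le_trans (cauchy_schwarz _ _) _.
  move: n1; rewrite ltr_pdivlMr// => /ltW; apply: le_trans.
  by rewrite mulrC ler_wpM2l// lerDl.
have := ler_normD (inner u (l - x n)) c; lra.
Unshelve. all: by end_near.
Qed.

End Riesz.

(** * Existence, homogeneity and composition of adjoints *)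

Section Adjoint.
Context {R : realType} {H G : hilbertType R}.
Variable L : {linear H -> G}.
Hypothesis bL : bounded_operator L.

(** Riesz representation of the bounded functional [u |-> inner (L u) y] makes the set inside [xget]
    nonempty. *)
Lemma adjointP y u : inner (L u) y = inner u (adjoint L y).
Proof.
have [x xP] : exists x, forall u, inner (L u) y = inner u x.
  have [M ML] := bL.
  apply: (@riesz_representation _ _ (fun u => inner (L u) y) (M * `|y|)).
    by move=> a v w; rewrite linearP innerDl innerZl.
  move=> v; apply: le_trans (cauchy_schwarz _ _) _.
  by rewrite mulrAC ler_wpM2r.
by rewrite /adjoint; case: xgetP => [_ _ /(_ u)//|/(_ x)].
Qed.

Lemma adjoint_unique y x : (forall u, inner (L u) y = inner u x) ->
  adjoint L y = x.
Proof. by move=> xP; apply: inner_eqP => u; rewrite -adjointP. Qed.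

Lemma adjointZ a y : adjoint L (a *: y) = a *: adjoint L y.
Proof. by apply: adjoint_unique => u; rewrite !innerZr adjointP. Qed.

End Adjoint.

Lemma bounded_operator_comp {R : realType} {K H G : hilbertType R}
    (S : K -> H) (L : H -> G) :
  bounded_operator S -> bounded_operator L -> bounded_operator (L \o S).
Proof.
(* The constant [M] may be negative; its absolute value allows multiplying the bound on [S] by
   it. *)
move=> [N NS] [M ML]; exists (`|M| * N) => x /=.
apply: le_trans (ML _) _; apply: (@le_trans _ _ (`|M| * `|S x|)).
  by rewrite ler_wpM2r// ler_norm.
by rewrite -mulrA ler_wpM2l.
Qed.

Lemma adjoint_comp {R : realType} {K H G : hilbertType R}
    (S : {linear K -> H}) (L : {linear H -> G}) :
  bounded_operator S -> bounded_operator L ->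
  adjoint (L \o S) = adjoint S \o adjoint L.
Proof.
move=> bS bL; apply/funext => y.
apply: (adjoint_unique (L \o S) (bounded_operator_comp S L bS bL)) => u /=.
by rewrite (adjointP L bL) (adjointP S bS).
Qed.

(** * Pointwise descriptions of the set-valued operations *)

Section Membership.
Context {R : realType}.

Lemma sv_eqP {V W : Type} (A B : V -> set W) :
  (forall x w, A x w <-> B x w) -> A = B.
Proof. by move=> AB; apply/funext => x; apply/seteqP; split=> w /AB. Qed.

Lemma sv_scaleP {V : lmodType R} (c : R) (A : V -> set V) x w :
  c != 0 -> sv_scale c A x w <-> A x (c^-1 *: w).
Proof.
move=> c0; split=> [[a Aa <-]|Aw]; first by rewrite scalerA mulVf// scale1r.
by exists (c^-1 *: w) => //; rewrite scalerA divff// scale1r.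
Qed.

Lemma sv_subvecP {V : lmodType R} (A : V -> set V) z x w :
  sv_subvec A z x w <-> A x (w + z).
Proof.
split=> [[a Aa <-]|Aw]; first by rewrite subrK.
by exists (w + z) => //; rewrite addrK.
Qed.

Lemma sv_add_scaleidP {V : lmodType R} (A : V -> set V) c x w :
  sv_add A (sv_scaleid V c) x w <-> A x (w - c *: x).
Proof.
split=> [[a Aa [_ -> <-]]|Aw]; first by rewrite addrK.
by exists (w - c *: x) => //; exists (c *: x) => //; rewrite subrK.
Qed.

Lemma yosidaP {V : lmodType R} (A : V -> set V) c x w :
  yosida c A x w <-> A (x - c *: w) w.
Proof. exact: sv_add_scaleidP. Qed.

Context {H G : hilbertType R}.
Implicit Types (L : H -> G) (C : G -> set G).

(** Subtracting [c^-1 *: x] forces the element of the parallel composition to be [w + c^-1 *: x]. *)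
Lemma resolvent_compP L c C x w : resolvent_comp L c C x w <->
  exists2 y, C y (L (w + c^-1 *: x) - c^-1 *: y) & adjoint L y = x.
Proof.
split=> [[v [y /sv_add_scaleidP Cy yx] [_ -> <-]]|[y Cy yx]].
  by exists y => //; rewrite subrK.
exists (w + c^-1 *: x); first by exists y => //; exact/sv_add_scaleidP.
by exists (c^-1 *: x) => //; rewrite addrK.
Qed.

(** This is [resolvent_compP] for [sv_inv C] and [c^-1], with [x] and [w] exchanged. *)
Lemma resolvent_cocompP L c C x w : resolvent_cocomp L c C x w <->
  exists2 y, C (L (x + c *: w) - c *: y) y & adjoint L y = w.
Proof. by rewrite -{2 3}(invrK c); exact: resolvent_compP. Qed.

End Membership.

(** * Calculus rules, each by comparing the arguments of [B] *)

Section Calculus.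
Context {R : realType} {H G : hilbertType R}.
Variable L : {linear H -> G}.
Hypothesis bL : bounded_operator L.
Implicit Types (B : G -> set G) (c r : R) (z : H).

Lemma resolvent_comp_scale r c B : r != 0 ->
  sv_scale r (resolvent_comp L c B) = resolvent_comp L (c / r) (sv_scale r B).
Proof.
move=> r0; apply: sv_eqP => x w; rewrite sv_scaleP// !resolvent_compP.
have E y : r^-1 *: (L (w + (c / r)^-1 *: x) - (c / r)^-1 *: y)
    = L (r^-1 *: w + c^-1 *: x) - c^-1 *: y.
  by rewrite scalerBr -linearZ/= scalerDr !scalerA invfM invrK mulrCA mulVf// mulr1.
by split=> -[y By yx]; exists y => //; move: By; rewrite sv_scaleP// E.
Qed.

Lemma resolvent_comp_prescale r c B : r != 0 ->
  sv_prescale (resolvent_comp L c B) r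
    = resolvent_comp L (c / r) (sv_prescale B r).
Proof.
move=> r0; apply: sv_eqP => x w; rewrite /sv_prescale !resolvent_compP.
have E y : L (w + c^-1 *: (r *: x)) - c^-1 *: (r *: y)
    = L (w + (c / r)^-1 *: x) - (c / r)^-1 *: y.
  by rewrite !scalerA invfM invrK.
split=> -[y By yx].
  (* Here [adjoint L y = r *: x], so the witness must be rescaled to be sent to [x]. *)
  exists (r^-1 *: y); last by rewrite adjointZ// yx scalerA mulVf// scale1r.
  have ry : r *: (r^-1 *: y) = y by rewrite scalerA divff// scale1r.
  by rewrite -E ry.
by exists (r *: y); rewrite ?E// adjointZ// yx.
Qed.

Lemma resolvent_cocomp_scale r c B : r != 0 ->
  sv_scale r (resolvent_cocomp L c B)
    = resolvent_cocomp L (c / r) (sv_scale r B).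
Proof.
move=> r0; apply: sv_eqP => x w; rewrite sv_scaleP// !resolvent_cocompP.
have E y : L (x + c *: (r^-1 *: w)) - c *: (r^-1 *: y)
    = L (x + (c / r) *: w) - (c / r) *: y.
  by rewrite !scalerA.
split=> -[y By yw].
  have ry : r^-1 *: (r *: y) = y by rewrite scalerA mulVf// scale1r.
  exists (r *: y); first by apply/sv_scaleP; rewrite // -E ry.
  by rewrite adjointZ// yw scalerA divff// scale1r.
exists (r^-1 *: y); first by rewrite E; move/sv_scaleP: By; apply.
by rewrite adjointZ// yw.
Qed.

Lemma resolvent_cocomp_prescale r c B : r != 0 ->
  sv_prescale (resolvent_cocomp L c B) r
    = resolvent_cocomp L (c / r) (sv_prescale B r).
Proof.
move=> r0; apply: sv_eqP => x w; rewrite /sv_prescale !resolvent_cocompP.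
have E y : r *: (L (x + (c / r) *: w) - (c / r) *: y)
    = L (r *: x + c *: w) - c *: y.
  by rewrite scalerBr -linearZ/= scalerDr !scalerA mulrCA divff// mulr1.
by split=> -[y By yx]; exists y => //; move: By; rewrite E.
Qed.

Lemma resolvent_comp_subvec c B z :
  sv_subvec (resolvent_comp L c B) z = resolvent_comp L c (sv_subvec B (L z)).
Proof.
apply: sv_eqP => x w; rewrite sv_subvecP !resolvent_compP.
have E y : L (w + c^-1 *: x) - c^-1 *: y + L z = L (w + z + c^-1 *: x) - c^-1 *: y.
  by rewrite addrAC -linearD/= (addrAC w).
by split=> -[y By yx]; exists y => //; move: By; rewrite sv_subvecP E.
Qed.

Lemma resolvent_cocomp_translate c B z :
  sv_translate z (resolvent_cocomp L c B)
    = resolvent_cocomp L c (sv_translate (L z) B).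
Proof.
apply: sv_eqP => x w; rewrite /sv_translate !resolvent_cocompP.
have E y : L (x + c *: w) - c *: y - L z = L (x - z + c *: w) - c *: y.
  by rewrite addrAC -linearB/= (addrAC x).
by split=> -[y By yw]; exists y => //; move: By; rewrite E.
Qed.

(** The outer witness is [adjoint L v] for the inner witness [v]. The term [c^-1 *: y] subtracted by
    the outer composition is added back by the inner one. *)
Lemma resolvent_comp_comp (K : hilbertType R) (S : {linear K -> H}) c B :
  bounded_operator S ->
  resolvent_comp S c (resolvent_comp L c B) = resolvent_comp (L \o S) c B.
Proof.
move=> bS; apply: sv_eqP => x w; rewrite !resolvent_compP adjoint_comp//.
split=> [[y /resolvent_compP[v Bv vy] yx]|[v Bv vx]].
  by exists v; [move: Bv; rewrite subrK | rewrite /= vy].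
exists (adjoint L v) => //; apply/resolvent_compP; exists v => //.
by rewrite subrK.
Qed.

Lemma resolvent_cocomp_comp (K : hilbertType R) (S : {linear K -> H}) c B :
  bounded_operator S ->
  resolvent_cocomp S c (resolvent_cocomp L c B) = resolvent_cocomp (L \o S) c B.
(* The two adjacent inverses between the compositions cancel by conversion. *)
Proof. by move=> bS; rewrite /resolvent_cocomp -resolvent_comp_comp. Qed.

Lemma resolvent_comp_add_scaleid r c B : c != 0 ->
  resolvent_comp L c (sv_add B (sv_scaleid G r))
    = sv_add (resolvent_comp L (c / (1 + r * c)) B) (sv_scaleid H r).
Proof.
move=> c0; apply: sv_eqP => x w; rewrite sv_add_scaleidP !resolvent_compP.
(* The parameter is chosen so that its inverse absorbs the added multiple [r] of the identity on
   both spaces. *)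
have -> : (c / (1 + r * c))^-1 = r + c^-1.
  by rewrite invfM invrK mulrC mulrDl mul1r mulfK// addrC.
have E y : L (w - r *: x + (r + c^-1) *: x) - (r + c^-1) *: y
    = L (w + c^-1 *: x) - c^-1 *: y - r *: y.
  by rewrite !scalerDl opprD !addrA subrK addrAC.
by split=> -[y By yx]; exists y => //; move: By; rewrite sv_add_scaleidP E.
Qed.

(** The shift of [x] by [- r *: w] lowers the weight of [w] from [c + r] to [c]; the leftover
    [- r *: y] is the shift in the Yosida approximation of [B]. *)
Lemma yosida_resolvent_cocomp r c B :
  yosida r (resolvent_cocomp L (c + r) B) = resolvent_cocomp L c (yosida r B).
Proof.
apply: sv_eqP => x w; rewrite yosidaP !resolvent_cocompP.
have E y : L (x - r *: w + (c + r) *: w) - (c + r) *: y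
    = L (x + c *: w) - c *: y - r *: y.
  by rewrite (addrC c) !scalerDl opprD !addrA subrK addrAC.
by split=> -[y By yw]; exists y => //; move: By; rewrite yosidaP E.
Qed.

Lemma yosida_resolvent_cocomp_diag c B :
  yosida c (resolvent_cocomp L c B) = adj_conj L (yosida c B).
Proof.
apply: sv_eqP => x w; rewrite yosidaP resolvent_cocompP subrK.
by split=> -[y By yw]; exists y => //; move: By; rewrite yosidaP.
Qed.

(** An operator and its Yosida approximation have the same zeros, since the shift [c *: w] vanishes
    at [w = 0]. *)
Lemma zer_resolvent_cocomp c B :
  sv_zer (resolvent_cocomp L c B) = sv_zer (adj_conj L (yosida c B)).
Proof.
rewrite -yosida_resolvent_cocomp_diag; apply/seteqP.
by split=> x; rewrite /sv_zer/= yosidaP scaler0 subr0.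
Qed.

End Calculus.

Theorem proposition3p1 (R : realType) (H G : hilbertType R)
    (L : {linear H -> G}) (bL : bounded_operator L) (B : G -> set G)
    (gamma rho : R) (gamma_gt0 : 0 < gamma) (rho_gt0 : 0 < rho) :
  (* (i) *)
  sv_dom (resolvent_comp L gamma B) `<=` adjoint L @` sv_dom B /\
  (* (ii) *)
  sv_ran (resolvent_cocomp L gamma B) `<=` adjoint L @` sv_ran B /\
  (* (iii) *)
  resolvent_comp L gamma B = sv_inv (resolvent_cocomp L gamma^-1 (sv_inv B)) /\
  (* (iv) *)
  sv_scale rho (resolvent_comp L gamma B)
    = resolvent_comp L (gamma / rho) (sv_scale rho B) /\
  (* (v) *)
  sv_prescale (resolvent_comp L gamma B) rho
    = resolvent_comp L (gamma / rho) (sv_prescale B rho) /\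
  (* (vi) *)
  sv_scale rho (resolvent_cocomp L gamma B)
    = resolvent_cocomp L (gamma / rho) (sv_scale rho B) /\
  (* (vii) *)
  sv_prescale (resolvent_cocomp L gamma B) rho
    = resolvent_cocomp L (gamma / rho) (sv_prescale B rho) /\
  (* (viii) *)
  (forall z : H,
    sv_subvec (resolvent_comp L gamma B) z
      = resolvent_comp L gamma (sv_subvec B (L z)) /\
    sv_translate z (resolvent_cocomp L gamma B)
      = resolvent_cocomp L gamma (sv_translate (L z) B)) /\
  (* (ix) *)
  (forall (K : hilbertType R) (S : {linear K -> H}), bounded_operator S ->
    resolvent_comp S gamma (resolvent_comp L gamma B)
      = resolvent_comp (L \o S) gamma B /\
    resolvent_cocomp S gamma (resolvent_cocomp L gamma B)
      = resolvent_cocomp (L \o S) gamma B) /\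
  (* (x) *)
  (let beta := gamma / (1 + rho * gamma) in
    resolvent_comp L gamma (sv_add B (sv_scaleid G rho))
      = sv_add (resolvent_comp L beta B) (sv_scaleid H rho)) /\
  (* (xi) *)
  yosida rho (resolvent_cocomp L (gamma + rho) B)
    = resolvent_cocomp L gamma (yosida rho B) /\
  (* (xii) *)
  yosida gamma (resolvent_cocomp L gamma B) = adj_conj L (yosida gamma B) /\
  (* (xiii) *)
  sv_zer (resolvent_cocomp L gamma B) = sv_zer (adj_conj L (yosida gamma B)).
Proof.
have g0 : gamma != 0 by rewrite gt_eqF.
have r0 : rho != 0 by rewrite gt_eqF.
split; first by move=> x [w /resolvent_compP[y By yx]]; exists y => //; eexists; exact: By.
split; first by move=> w [x /resolvent_cocompP[y By yw]]; exists y => //; eexists; exact: By.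
(* Once the parameter is restored, both double inverses vanish by conversion. *)
split; first by rewrite /resolvent_cocomp invrK.
split; first exact: resolvent_comp_scale.
split; first exact: resolvent_comp_prescale.
split; first exact: resolvent_cocomp_scale.
split; first exact: resolvent_cocomp_prescale.
split.
  by move=> z; rewrite resolvent_comp_subvec resolvent_cocomp_translate.
split.
  by move=> K S bS; rewrite resolvent_comp_comp// resolvent_cocomp_comp.
split; first exact: resolvent_comp_add_scaleid.
split; first exact: yosida_resolvent_cocomp.
split; first exact: yosida_resolvent_cocomp_diag.
exact: zer_resolvent_cocomp.
Qed.
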